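(* Let $H\in\mathbb{R}^{n\times n}$ be symmetric positive semi-definite, and let $\mathcal{S}(H)$ be the set of symmetric positive semi-definite $\tilde H\in\mathbb{R}^{n\times n}$ having the same eigenvalues as $H$, counted with multiplicity. Then $$\sup_{\tilde H\in\mathcal{S}(H)}\mathcal{L}_{\mathrm{worst}}(\mathsf{LDLQ},\tilde H)=\mathcal{L}_{\mathrm{worst}}(\mathsf{Stoch},H)=\tfrac{m}{4}\operatorname{tr}(H).$$ Moreover, if $\mathsf{LDLQ}$ uses nearest rounding as its subroutine $\mathcal{Q}$ (resp. stochastic rounding), then $$\sup_{\tilde H\in\mathcal{S}(H)}\mathcal{L}_{\mathrm{avg}}(\mathsf{LDLQ},\tilde H)=\mathcal{L}_{\mathrm{avg}}(\mathcal{B},H)=\tfrac{m}{c}\operatorname{tr}(H),$$ with $\mathcal{B}=\mathsf{Near}$ and $c=12$ (resp. $\mathcal{B}=\mathsf{Stoch}$ and $c=6$).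
   Context: Nearest rounding maps $z$ to a nearest integer. Unbiased stochastic rounding maps $z$ to $\lfloor z\rfloor+1$ with probability $z-\lfloor z\rfloor$ and to $\lfloor z\rfloor$ otherwise, independently each time. $\mathsf{LDLQ}$, with rounding subroutine $\mathcal{Q}$ applied entrywise, works as follows: given $W\in\mathbb{R}^{m\times n}$ and $H$ with LDL decomposition $H=(\grave U+I)D(\grave U+I)^T$ ($\grave U$ strictly upper triangular, $D$ nonnegative diagonal), compute for $k=1,\dots,n$ the column $\hat W_k=\mathcal{Q}(W_k+(W-\hat W)\grave U_k)$, where $X_k$ is the $k$-th column of $X$. $\mathsf{Near}$ / $\mathsf{Stoch}$ apply nearest / stochastic rounding entrywise to $W$. Proxy losses: $\mathcal{L}_{\mathrm{worst}}(\mathcal{A},H)=\sup_{W\in\mathbb{R}^{m\times n}}\mathbb{E}[\operatorname{tr}((\mathcal{A}(W,H)-W)H(\mathcal{A}(W,H)-W)^T)]$ and $\mathcal{L}_{\mathrm{avg}}(\mathcal{A},H)=\mathbb{E}_{W\sim\mathrm{Unif}[0,1]^{m\times n}}[\operatorname{tr}((\mathcal{A}(W,H)-W)H(\mathcal{A}(W,H)-W)^T)]$, with expectation over the rounding randomness (and over $W$). *)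

(* Defs.v *)
From HB Require Import structures.
From mathcomp Require Import all_boot all_order all_algebra.
From mathcomp Require Import all_classical all_reals all_analysis.
Set Implicit Arguments. Unset Strict Implicit. Unset Printing Implicit Defensive.
Import Order.TTheory GRing.Theory Num.Theory.
Local Open Scope ring_scope.
Local Open Scope classical_set_scope.

Section Defs.
Variable R : realType.

Definition floorR (z : R) : R := (Num.floor z)%:~R.
Definition fracR (z : R) : R := z - floorR z.

(* nearest rounding (ties rounded up; ties are irrelevant for the sup / the average) *)
Definition near_round (z : R) : R := floorR (z + 2^-1).

Definition psd n (A : 'M[R]_n) : Prop :=
  A^T = A /\ forall v : 'rV[R]_n, 0 <= (v *m A *m v^T) 0 0.

Definition same_spectrum_set n (H : 'M[R]_n) : set 'M[R]_n :=
  [set Ht | psd Ht /\ char_poly Ht = char_poly H].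

Definition is_LDL n (A U : 'M[R]_n) (d : 'rV[R]_n) : Prop :=
  [/\ (forall i j : 'I_n, (j <= i)%N -> U i j = 0),
      (forall i, 0 <= d 0 i) &
      A = (U + 1%:M) *m diag_mx d *m (U + 1%:M)^T].

Definition qloss m n (A W : 'M[R]_(m, n)) (H : 'M[R]_n) : R :=
  \tr ((A - W) *m H *m (A - W)^T).

(* LDLQ with an entrywise rounding function rnd i k (which may depend on the
   entry position, to encode per-entry random bits). *)
Definition ldlq_step m n (rnd : 'I_m -> 'I_n -> R -> R) (W : 'M[R]_(m, n))
  (U : 'M[R]_n) (A : 'M[R]_(m, n)) (t : nat) : 'M[R]_(m, n) :=
  \matrix_(i, j) if (j < t)%N then A i j
                 else if (j == t :> nat) then rnd i j (W i j + ((W - A) *m U) i j)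
                 else 0.

Fixpoint ldlq_iter m n rnd W U (k : nat) : 'M[R]_(m, n) :=
  match k with
  | 0 => 0
  | k'.+1 => ldlq_step rnd W U (@ldlq_iter m n rnd W U k') k'
  end.

Definition ldlq m n rnd W U : 'M[R]_(m, n) := @ldlq_iter m n rnd W U n.

Definition ldlq_arg m n rnd (W : 'M[R]_(m, n)) U : 'M[R]_(m, n) :=
  \matrix_(i, j) (W i j + ((W - @ldlq_iter m n rnd W U j) *m U) i j).

(* stochastic rounding encoded by bits b: round up iff b (i,k) *)
Definition bit_round m n (b : {ffun 'I_m * 'I_n -> bool}) : 'I_m -> 'I_n -> R -> R :=
  fun i k z => floorR z + (b (i, k))%:R.

Definition bit_prob (bit : bool) (z : R) : R := if bit then fracR z else 1 - fracR z.

Definition E_ldlq_near m n (U : 'M[R]_n) (W : 'M[R]_(m, n)) (H : 'M[R]_n) : R :=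
  qloss (ldlq (fun _ _ => near_round) W U) W H.

(* Expected loss of LDLQ with unbiased stochastic rounding, each rounding using
   an independent coin: sum over all bit patterns of probability * loss. *)
Definition E_ldlq_stoch m n (U : 'M[R]_n) (W : 'M[R]_(m, n)) (H : 'M[R]_n) : R :=
  \sum_(b : {ffun 'I_m * 'I_n -> bool})
     (\prod_(p : 'I_m * 'I_n) bit_prob (b p) (ldlq_arg (bit_round b) W U p.1 p.2))
     * qloss (ldlq (bit_round b) W U) W H.

Definition E_near m n (W : 'M[R]_(m, n)) (H : 'M[R]_n) : R :=
  qloss (map_mx near_round W) W H.

Definition E_stoch m n (W : 'M[R]_(m, n)) (H : 'M[R]_n) : R :=
  \sum_(b : {ffun 'I_m * 'I_n -> bool})
     (\prod_(p : 'I_m * 'I_n) bit_prob (b p) (W p.1 p.2))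
     * qloss (\matrix_(i, j) (floorR (W i j) + (b (i, j))%:R)) W H.

Definition L_worst m n (E : 'M[R]_(m, n) -> R) : \bar R :=
  ereal_sup [set (E W)%:E | W in [set: 'M[R]_(m, n)]].

(* Expectation over W ~ Unif[0,1]^{m x n}: iterated Lebesgue integrals over
   each entry (independent uniform coordinates). *)
Definition set_entry m n (W : 'M[R]_(m, n)) (e : 'I_m * 'I_n) (x : R) : 'M[R]_(m, n) :=
  \matrix_(i, j) if (i, j) == e then x else W i j.

Fixpoint iter_unif m n (s : seq ('I_m * 'I_n)) (F : 'M[R]_(m, n) -> R)
  (W : 'M[R]_(m, n)) : R :=
  match s with
  | [::] => F W
  | e :: s' => Rintegral lebesgue_measure `[0%R, 1%R]
                 (fun x => @iter_unif m n s' F (set_entry W e x))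
  end.

Definition L_avg m n (E : 'M[R]_(m, n) -> R) : R :=
  iter_unif (enum [set: 'I_m * 'I_n]) E 0.

End Defs.

(* Main.v *)
(* Since (W^ - W)(U + I) = eta, the matrix of rounding errors of the arguments that
   LDLQ actually rounds, the loss of LDLQ is the sum of the d_k eta_ik^2.  Each
   expected eta_ik^2 is at most 1/4, and averages over W to 1/12 (nearest) or 1/6
   (stochastic) because W_ik enters its own rounding argument additively and the
   error is 1-periodic.  Comparing diagonals in H~ = (U + I) D (U + I)^T gives
   tr D <= tr H~ = tr H.  Equality holds when H~ is the diagonal matrix of the
   eigenvalues of H: then D = H~, the columns of U with d_k <> 0 vanish, and LDLQ
   rounds W itself in all the columns that contribute to the loss.  For entrywise
   rounding, the errors of distinct entries are uncorrelated, so that only the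
   diagonal of H matters. *)

Require Import Defs.
From HB Require Import structures.
From mathcomp Require Import all_boot all_order all_algebra.
From mathcomp Require Import all_classical all_reals all_analysis.
From mathcomp Require Import complex measurable_realfun zify lra ring.
Import Order.TTheory GRing.Theory Num.Theory.
Import numFieldNormedType.Exports.
Local Open Scope ring_scope.
Local Open Scope classical_set_scope.

(** * Quadratic polynomials in the fractional part, averaged over [[0, 1]] *)

Lemma integrable_setU_disjoint d (T : measurableType d) (R : realType)
    (mu : {measure set T -> \bar R}) (A B : set T) (f : T -> \bar R) :
  measurable A -> measurable B -> [disjoint A & B] ->
  mu.-integrable A f -> mu.-integrable B f -> mu.-integrable (A `|` B) f.
Proof.
move=> mA mB AB /integrableP[mfA fA] /integrableP[mfB fB].
have mf : measurable_fun (A `|` B) f by apply/measurable_funU.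
apply/integrableP; split=> //; rewrite ge0_integral_setU//; first exact: lte_add_pinfty.
exact: measurableT_comp.
Qed.

Section Frac.
Set Implicit Arguments.
Unset Strict Implicit.
Context {R : realType}.
Implicit Types (x a b c s t z : R) (k : int).
Local Notation mu := (@lebesgue_measure R).

Lemma fracR_ge0 z : 0 <= fracR z.
Proof. by rewrite /fracR /floorR subr_ge0 ge_floor. Qed.

Lemma fracR_lt1 z : fracR z < 1.
Proof. by rewrite /fracR /floorR ltrBlDl -intrD1 floorD1_gt. Qed.

Lemma fracR_eq z k : k%:~R <= z < k%:~R + 1 -> fracR z = z - k%:~R.
Proof. by rewrite -intrD1 => /floor_def kz; rewrite /fracR /floorR kz. Qed.

Lemma near_roundE z : near_round z - z = 2^-1 - fracR (z + 2^-1).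
Proof. by rewrite /near_round /fracR; ring. Qed.

Let q c0 c1 c2 t : R := c0 + c1 * t + c2 * t ^+ 2.
Let Q c0 c1 c2 t : R := c0 * t + c1 / 2 * t ^+ 2 + c2 / 3 * t ^+ 3.

Let cq c0 c1 c2 s : continuous (fun x => q c0 c1 c2 (x + s)).
Proof.
move=> x; rewrite /q; apply: cvgD; first apply: cvgD; first exact: cvg_cst.
  apply: cvgM; first exact: cvg_cst.
  by apply: cvgD; [exact: cvg_id|exact: cvg_cst].
apply: cvgM; first exact: cvg_cst.
by apply: cvgM; apply: cvgD; (exact: cvg_id || exact: cvg_cst).
Qed.

Let dQ c0 c1 c2 s x : is_derive x 1 (fun x => Q c0 c1 c2 (x + s)) (q c0 c1 c2 (x + s)).
Proof.
rewrite /Q /q.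
apply: is_derive_eq.
by rewrite /GRing.scale /=; field.
Qed.

Let integrable_q c0 c1 c2 s a b :
  mu.-integrable `[a, b] (EFin \o (fun x => q c0 c1 c2 (x + s))).
Proof.
apply: continuous_compact_integrable; first exact: segment_compact.
by apply: continuous_subspaceT; exact: cq.
Qed.

Let Rintegral_q c0 c1 c2 s a b : a <= b ->
  \int[mu]_(x in `[a, b]) q c0 c1 c2 (x + s) = Q c0 c1 c2 (b + s) - Q c0 c1 c2 (a + s).
Proof.
rewrite le_eqVlt => /predU1P[->|ab]; first by rewrite set_itv1 Rintegral_set1 subrr.
rewrite /Rintegral (@continuous_FTC2 _ _ (fun x => Q c0 c1 c2 (x + s)))//.
- by apply: continuous_subspaceT; exact: cq.
- have cQ x : {for x, continuous (fun x => Q c0 c1 c2 (x + s))}.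
    by apply: differentiable_continuous; apply/derivable1_diffP; case: (dQ c0 c1 c2 s x).
  split.
  + by move=> x _; case: (dQ c0 c1 c2 s x).
  + by apply: cvg_at_right_filter; exact: cQ.
  + by apply: cvg_at_left_filter; exact: cQ.
- by move=> x _; rewrite derive1E; case: (dQ c0 c1 c2 s x).
Qed.

(** As [x] runs over [[0, 1]], the floor of [x + a] jumps once, at [x = 1 - fracR a]. *)
Let fracR_pieces a x : 0 <= x <= 1 ->
  fracR (x + a) = if x < 1 - fracR a then x + fracR a else x + (fracR a - 1).
Proof.
move=> /andP[x0 x1].
have := fracR_ge0 a; have := fracR_lt1 a; set t := fracR a => t1 t0.
have aE : a = t + floorR a by rewrite /t /fracR subrK.
case: ltP => xt.
  rewrite (@fracR_eq _ (Num.floor a)); last by rewrite -/(floorR a); lra.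
  by rewrite -/(floorR a); lra.
rewrite (@fracR_eq _ (Num.floor a + 1)); first by rewrite intrD1 -/(floorR a); lra.
by rewrite intrD1 -/(floorR a); lra.
Qed.

(** The shift [a] drops out because [fracR] is 1-periodic: cut at [1 - t] with [t = fracR a], the
    two pieces become the integrals of the polynomial over [[t, 1]] and [[0, t]]. Integrability
    comes along because linearity of the integral uses it. *)
Lemma integral_fracR_quadratic c0 c1 c2 a :
  let f x : R := c0 + c1 * fracR (x + a) + c2 * fracR (x + a) ^+ 2 in
  mu.-integrable `[0, 1] (EFin \o f) /\
  \int[mu]_(x in `[0, 1]) f x = c0 + c1 / 2 + c2 / 3.
Proof.
move=> f; have := fracR_ge0 a; have := fracR_lt1 a; set t := fracR a => t1 t0.
have t'0 : 0 <= 1 - t by lra.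
have t'1 : 1 - t <= 1 by lra.
have fl x : 0 <= x < 1 - t -> f x = q c0 c1 c2 (x + t).
  by move=> /andP[x0 xt]; rewrite /f /q fracR_pieces ?xt//; lra.
have fr x : 1 - t <= x <= 1 -> f x = q c0 c1 c2 (x + (t - 1)).
  by move=> /andP[xt x1]; rewrite /f /q fracR_pieces ?ltNge ?xt//; lra.
have Il : mu.-integrable `[0, 1 - t[ (EFin \o f).
  apply: (@eq_integrable _ _ _ mu _ _
    (EFin \o (fun x => q c0 c1 c2 (x + t))) (EFin \o f)) => //.
    by move=> x /set_mem /=; rewrite in_itv /= => xt; rewrite fl.
  apply: integrableS (integrable_q c0 c1 c2 t 0 (1 - t)) => //.
  by move=> x /=; rewrite !in_itv/= => /andP[-> /ltW].
have Ir : mu.-integrable `[1 - t, 1] (EFin \o f).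
  apply: (@eq_integrable _ _ _ mu _ _
    (EFin \o (fun x => q c0 c1 c2 (x + (t - 1)))) (EFin \o f)) => //.
  by move=> x /set_mem /=; rewrite in_itv /= => xt; rewrite fr.
have splitE : `[0, 1]%classic = `[0, 1 - t[ `|` `[1 - t, 1] :> set R.
  by rewrite -itv_bndbnd_setU// bnd_simp.
have disj : [disjoint `[0, 1 - t[%classic & `[1 - t, 1]%classic].
  apply/disj_setPS => y [/=]; rewrite !in_itv/= => /andP[_ yx] /andP[].
  by rewrite leNgt yx.
have I01 : mu.-integrable `[0, 1] (EFin \o f).
  by rewrite splitE; apply: integrable_setU_disjoint.
split=> //; rewrite splitE Rintegral_setU -?splitE//.
rewrite (@eq_Rintegral _ _ R mu `[0, 1 - t[%classic
  (fun x => q c0 c1 c2 (x + t)) f); last first.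
  by move=> x /set_mem /=; rewrite in_itv /= => xt; rewrite fl.
rewrite (@eq_Rintegral _ _ R mu `[1 - t, 1]%classic
  (fun x => q c0 c1 c2 (x + (t - 1))) f); last first.
  by move=> x /set_mem /=; rewrite in_itv /= => xt; rewrite fr.
rewrite Rintegral_itv_bndo_bndc; last first.
  apply: integrableS (integrable_q c0 c1 c2 t 0 (1 - t)) => //.
  by move=> x /=; rewrite !in_itv/= => /andP[-> /ltW].
rewrite !Rintegral_q// /Q.
by field.
Qed.

(** Each average over one entry is brought to this shape: [C] collects what does not involve the
    variable, and [I] is either a single index or the set of all coin patterns. *)
Lemma Rintegral_sum_fracR (I : finType) (c0 c1 c2 a : I -> R) (C : R) :
  \int[mu]_(x in `[0, 1]) (C + \sum_i (c0 i + c1 i * fracR (x + a i)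
                                       + c2 i * fracR (x + a i) ^+ 2)) =
  C + \sum_i (c0 i + c1 i / 2 + c2 i / 3).
Proof.
set f := fun i x => c0 i + c1 i * fracR (x + a i) + c2 i * fracR (x + a i) ^+ 2.
rewrite -[LHS]/(\int[mu]_(x in `[0, 1]) (C + \sum_i f i x)).
have If i : mu.-integrable `[0, 1] (EFin \o f i).
  by case: (integral_fracR_quadratic (c0 i) (c1 i) (c2 i) (a i)).
have Ef i : \int[mu]_(x in `[0, 1]) f i x = c0 i + c1 i / 2 + c2 i / 3.
  by case: (integral_fracR_quadratic (c0 i) (c1 i) (c2 i) (a i)).
have IC : mu.-integrable `[0, 1] (EFin \o (fun _ : R => C)).
  apply: continuous_compact_integrable; first exact: segment_compact.
  by apply: continuous_subspaceT => x; exact: cvg_cst.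
have Is (r : seq I) : mu.-integrable `[0, 1] (EFin \o (fun x => \sum_(i <- r) f i x)).
  apply: (@eq_integrable _ _ _ mu _ _ (fun x => \sum_(i <- r) (f i x)%:E)%E
    (EFin \o (fun x => \sum_(i <- r) f i x))) => //.
    by move=> x _; rewrite /= sumEFin.
  by apply: integrable_sum => // i _; exact: If.
rewrite RintegralD//; congr (_ + _).
  by rewrite Rintegral_cst//= lebesgue_measure_itv /= lte01 oppr0 adde0 mulr1.
elim: (index_enum I) => [|i r IH].
  by under eq_Rintegral do rewrite big_nil; rewrite big_nil Rintegral_cst// mul0r.
under eq_Rintegral do rewrite big_cons.
by rewrite RintegralD// Ef big_cons IH.
Qed.

End Frac.

(** * Traces, characteristic polynomials and the diagonal matrix of eigenvalues *)

Section Spectrum.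
Set Implicit Arguments.
Unset Strict Implicit.
Context {R : realType}.

Lemma psd_diag n (A : 'M[R]_n) i : psd A -> 0 <= A i i.
Proof.
case=> _ /(_ (delta_mx 0 i)); rewrite -rowE mxE (bigD1 i)//= big1 => [|j ji].
  by rewrite !mxE !eqxx mulr1 addr0.
by rewrite !mxE eqxx (negPf ji) mulr0.
Qed.

Lemma psd_eigenvalue_ge0 n (A : 'M[R]_n) a : psd A -> eigenvalue A a -> 0 <= a.
Proof.
move=> [_ Apos] /eigenvalueP[v vA v0].
have := Apos v; rewrite vA -scalemxAl mxE.
have: 0 < (v *m v^T) 0 0.
  have [j vj0] : exists j, v 0 j != 0.
    apply/existsP; apply: contra_neqT v0 => /existsPn v0.
    by apply/rowP => j; rewrite mxE; apply/eqP; rewrite -[_ == _]negbK; exact: v0.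
  rewrite mxE (bigD1 j)//= ltr_pwDl//.
    by rewrite mxE -expr2 exprn_even_gt0.
  by apply: sumr_ge0 => k _; rewrite mxE -expr2 sqr_ge0.
by move=> v_gt0; rewrite pmulr_lge0.
Qed.

Lemma char_poly_diag_mx n (d : 'rV[R]_n) :
  char_poly (diag_mx d) = \prod_i ('X - (d 0 i)%:P).
Proof.
rewrite char_poly_trig ?diag_mx_is_trig//.
by apply: eq_bigr => i _; rewrite mxE eqxx mulr1n.
Qed.

Lemma same_spectrum_trace n (A B : 'M[R]_n) :
  char_poly A = char_poly B -> \tr A = \tr B.
Proof.
case: n A B => [|n] A B AB; first by rewrite /mxtrace !big_ord0.
by apply: oppr_inj; rewrite -!char_poly_trace// AB.
Qed.

Lemma similar_char_poly (F : fieldType) n (P A B : 'M[F]_n) : P \in unitmx ->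
  A = invmx P *m B *m P -> char_poly A = char_poly B.
Proof.
move=> Pu ->; rewrite /char_poly.
have PVP : map_mx polyC (invmx P) *m map_mx polyC P = 1%:M.
  by rewrite -map_mxM mulVmx// map_mx1.
have -> : char_poly_mx (invmx P *m B *m P) =
    map_mx polyC (invmx P) *m char_poly_mx B *m map_mx polyC P.
  rewrite /char_poly_mx mulmxBr mulmxBl !map_mxM; congr (_ - _).
  by rewrite scalar_mxC -mulmxA PVP mulmx1.
by rewrite !det_mulmx mulrAC -det_mulmx PVP det1 mul1r.
Qed.

(** Over the complex numbers [A] becomes Hermitian, and the spectral theorem diagonalizes it with
    real entries. The equality of characteristic polynomials descends to [R] because the embedding
    is injective on polynomials. *)
Lemma symmetric_char_poly_split n (A : 'M[R]_n) : A^T = A ->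
  exists d : 'rV[R]_n, char_poly A = char_poly (diag_mx d).
Proof.
move=> symA; pose AC := map_mx (real_complex R) A.
have hermA : AC \is hermsymmx.
  apply: realsym_hermsym.
    by apply/is_hermitianmxP; rewrite expr0 scale1r map_mx_id// map_trmx symA.
  by apply/mxOverP => i j; rewrite mxE; apply/complex_realP; exists (A i j).
have /hermitian_normalmx /orthomx_spectralP := hermA.
have := hermitian_spectral_diag_real hermA.
set P := spectralmx AC; set D := spectral_diag AC => /mxOverP realD AE.
pose d : 'rV[R]_n := map_mx (@complex.Re R) D.
have DE : D = map_mx (real_complex R) d.
  by apply/rowP => j; rewrite !mxE; have /complex_realP[k ->] := realD 0 j.
exists d; apply: (map_poly_inj (real_complex R)); rewrite !map_char_poly.
have Pu : P \in unitmx := spectral_unit AC.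
have -> : map_mx (real_complex R) (diag_mx d) = diag_mx D by rewrite DE map_diag_mx.
rewrite -/AC; exact: similar_char_poly Pu AE.
Qed.

(** This diagonal matrix is where the suprema over the matrices with the spectrum of [H] are
    attained. Its entries are eigenvalues of [H], hence nonnegative. *)
Lemma psd_diag_same_spectrum n (H : 'M[R]_n) : psd H ->
  exists d : 'rV[R]_n, same_spectrum_set H (diag_mx d).
Proof.
move=> psdH; have [d dE] := symmetric_char_poly_split (proj1 psdH).
exists d; split; last by rewrite dE.
have d_ge0 i : 0 <= d 0 i.
  apply: (psd_eigenvalue_ge0 psdH); rewrite eigenvalue_root_char dE char_poly_diag_mx.
  rewrite /root horner_prod; apply/prodf_eq0; exists i => //.
  by rewrite !hornerE subrr.
split; first by rewrite tr_diag_mx.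
move=> v; rewrite mul_mx_diag mxE; apply: sumr_ge0 => i _; rewrite !mxE.
by rewrite mulrAC -expr2 mulr_ge0// sqr_ge0.
Qed.
End Spectrum.

(** * Iterated averages over the entries of [W], one entry at a time *)

Section IteratedIntegral.
Set Implicit Arguments.
Unset Strict Implicit.
Context {R : realType}.
Local Notation mu := (@lebesgue_measure R).

Section Positions.
Context {m n : nat}.
Implicit Types (p q e : 'I_m * 'I_n).

(* Position in the row-major order in which L_avg enumerates the entries. *)
Definition rank p : nat := p.1 * n + p.2.

Lemma rank_inj : injective rank.
Proof.
case=> [i j] [i' j'] /= E; move: (E); rewrite /rank /=.
have j_lt := ltn_ord j; have j'_lt := ltn_ord j'.
move=> E'; have ii' : i = i' :> nat by nia.
by congr pair; apply: val_inj => //=; move: E'; rewrite ii'; lia.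
Qed.

Lemma rank_lt i (j k : 'I_n) : (rank (i, j) < rank (i, k))%N = (j < k)%N.
Proof. by rewrite /rank ltn_add2l. Qed.

Lemma rank_le i (j k : 'I_n) : (rank (i, j) <= rank (i, k))%N = (j <= k)%N.
Proof. by rewrite /rank leq_add2l. Qed.

Lemma enum_setT_rank_sorted :
  pairwise (fun p q => rank p < rank q)%N (enum [set: 'I_m * 'I_n]).
Proof.
have -> : enum [set: 'I_m * 'I_n] = [seq (i, j) | i <- enum 'I_m, j <- enum 'I_n].
  rewrite [in LHS]/enum_mem (eq_filter (a2 := predT)) ?filter_predT.
    by rewrite -[RHS]/(prod_enum _ _) unlock.
  by move=> p; exact: (@mem_set _ [set: _] p).
have ltI k : pairwise (fun i j : 'I_k => i < j)%N (enum 'I_k).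
  rewrite -(pairwise_map val ltn) val_enum_ord -sorted_pairwise ?iota_ltn_sorted//.
  exact: ltn_trans.
elim: (enum 'I_m) (ltI m) => //= i s IHs /andP[i_lt /IHs IH].
rewrite pairwise_cat IH andbT; apply/andP; split.
  apply/allrelP => _ _ /mapP[j _ ->] /allpairsP[[i' j'] /= [i's _ ->]].
  move/allP: i_lt => /(_ _ i's); rewrite /rank /=.
  by have := ltn_ord j; nia.
rewrite pairwise_map; apply: sub_pairwise (ltI n) => j j' /=.
by rewrite rank_lt.
Qed.

Lemma set_entry_eq (W : 'M[R]_(m, n)) p x : set_entry W p x p.1 p.2 = x.
Proof. by rewrite mxE -surjective_pairing eqxx. Qed.

Lemma set_entry_neq (W : 'M[R]_(m, n)) p e x : p != e ->
  set_entry W e x p.1 p.2 = W p.1 p.2.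
Proof. by move=> pe; rewrite mxE -surjective_pairing (negPf pe). Qed.

(* L_avg integrates out the entries of highest rank first.  When the entry p is
   reached, the summands of higher rank have become constants and those of lower
   rank do not involve p, so that no measurability of the iterated integrals is
   needed. *)
Lemma L_avg_sum (T : 'I_m * 'I_n -> 'M[R]_(m, n) -> R) (c : 'I_m * 'I_n -> R) :
  (forall p e W x, (rank p < rank e)%N -> T p (set_entry W e x) = T p W) ->
  (forall p W C, \int[mu]_(x in `[0, 1]) (C + T p (set_entry W p x)) = C + c p) ->
  L_avg (fun W => \sum_p T p W) = \sum_p c p.
Proof.
move=> Tloc Tint; rewrite /L_avg.
(* Induction over the suffixes [s] of the enumeration: terms of entries before [s] are still
   functions of [W], whereas those of entries in [s] have been replaced by their averages. *)
have suffix s W : pairwise (fun p q => rank p < rank q)%N s ->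
    (forall p e, p \notin s -> e \in s -> (rank p < rank e)%N) ->
    iter_unif s (fun W => \sum_p T p W) W =
    \sum_(p | p \notin s) T p W + \sum_(p | p \in s) c p.
  elim: s W => [|e s IHs] W /=.
    by move=> _ _; rewrite [X in _ + X]big_pred0 ?addr0.
  move=> /andP[e_lt s_lt] lt_s.
  have e_s : e \notin s by apply/negP => /(allP e_lt); rewrite ltnn.
  have sP (F : _ -> R) : \sum_(p | p \notin s) F p = \sum_(p | p \notin e :: s) F p + F e.
    rewrite (bigD1 e)//= addrC; congr (_ + _); apply: eq_bigl => p.
    by rewrite inE negb_or andbC.
  (* The terms outside [e :: s] have lower rank than [e] and ignore [x]; only the term of [e] is
     really integrated. *)
  under eq_Rintegral => x _.
    rewrite IHs//; last first.
      move=> p q; have [->|pe ps qs] := eqVneq p e; first by move=> _ /(allP e_lt).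
      by apply: lt_s; rewrite inE ?negb_or ?pe ?ps ?qs ?orbT.
    rewrite sP addrAC.
    under eq_bigr => p p_es do rewrite Tloc ?lt_s ?mem_head//.
    over.
  rewrite Tint -addrA; congr (_ + _).
  rewrite [in RHS](bigD1 e) ?mem_head//= addrC; congr (_ + _); apply: eq_bigl => p.
  by rewrite inE; case: eqVneq => [->|//]; rewrite ?(negPf e_s) ?andbT//.
have memT p : p \in enum [set: 'I_m * 'I_n] by rewrite mem_enum; exact: mem_set.
rewrite suffix; last first.
- by move=> p e; rewrite memT.
- exact: enum_setT_rank_sorted.
rewrite big_pred0 => [|p]; last by rewrite memT.
by rewrite add0r; apply: eq_bigl => p; rewrite memT.
Qed.
End Positions.
End IteratedIntegral.

(** * The recursion behind LDLQ, its rounding errors, and LDL decompositions *)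

Section Algorithm.
Set Implicit Arguments.
Unset Strict Implicit.
Context {R : realType}.

Section LDLQ.
Context {m n : nat}.
Implicit Types (W : 'M[R]_(m, n)) (U : 'M[R]_n) (d : 'rV[R]_n).
Implicit Types (rnd : 'I_m -> 'I_n -> R -> R).

Definition strict_upper U := forall i j : 'I_n, (j <= i)%N -> U i j = 0.

(** Step [j] writes column [j] and all later steps copy it. *)
Lemma ldlq_iter_col rnd W U t i (j : 'I_n) : (j < t)%N ->
  ldlq_iter rnd W U t i j = rnd i j (ldlq_arg rnd W U i j).
Proof.
elim: t => // t IH; rewrite ltnS leq_eqVlt /= mxE => /predU1P[<-|jt].
  by rewrite ltnn eqxx; congr (rnd _ _ _); rewrite /ldlq_arg [RHS]mxE.
by rewrite jt IH.
Qed.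

Lemma ldlq_col rnd W U i j : ldlq rnd W U i j = rnd i j (ldlq_arg rnd W U i j).
Proof. exact: ldlq_iter_col. Qed.

Lemma ldlq_argE rnd W U i j : strict_upper U ->
  ldlq_arg rnd W U i j =
  W i j + \sum_(l < n | (l < j)%N) (W i l - rnd i l (ldlq_arg rnd W U i l)) * U l j.
Proof.
move=> Uup; rewrite [in LHS]/ldlq_arg mxE; congr (_ + _).
rewrite mxE [RHS]big_mkcond /=; apply: eq_bigr => l _.
case: ltnP => [lj|jl]; last by rewrite Uup ?mulr0.
have -> (A : 'M[R]_(m, n)) : (W - A) i l = W i l - A i l by rewrite !mxE.
by rewrite ldlq_iter_col.
Qed.

(** Causality, by strong induction on the column. The bound on the roundings is strict, so that an
    argument does not depend on the coin that will round it. *)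
Lemma ldlq_arg_ext rnd rnd' W W' U i (j : 'I_n) : strict_upper U ->
  (forall l : 'I_n, (l <= j)%N -> W i l = W' i l) ->
  (forall l : 'I_n, (l < j)%N -> rnd i l =1 rnd' i l) ->
  ldlq_arg rnd W U i j = ldlq_arg rnd' W' U i j.
Proof.
move=> Uup; have [k] := ubnP (val j); elim: k j => // k IH j /ltnSE jk WW' rr'.
rewrite !ldlq_argE// WW'//; congr (_ + _); apply: eq_bigr => l lj.
rewrite WW' ?rr' ?(IH l) ?(ltnW lj)//; first exact: leq_trans lj jk.
- by move=> l' l'l; rewrite WW'// (leq_trans l'l)// ltnW.
- by move=> l' l'l; apply: rr'; apply: ltn_trans l'l lj.
Qed.

(** The feedback comes from earlier columns and does not change with [x], so varying the entry
    merely shifts its own rounding argument. *)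
Lemma ldlq_arg_set_entry rnd W U i j x : strict_upper U ->
  ldlq_arg rnd (set_entry W (i, j) x) U i j = x + (ldlq_arg rnd W U i j - W i j).
Proof.
move=> Uup; rewrite !ldlq_argE// [set_entry W (i, j) x i j]mxE eqxx.
rewrite [W i j + _]addrC addrK; congr (_ + _); apply: eq_bigr => l lj.
have keep (l' : 'I_n) : (l' < j)%N -> set_entry W (i, j) x i l' = W i l'.
  by move=> l'j; rewrite mxE xpair_eqE eqxx /= -val_eqE /= ltn_eqF.
rewrite keep// (ldlq_arg_ext (rnd' := rnd) (W' := W))// => l' l'l.
by rewrite keep// (leq_ltn_trans l'l).
Qed.

Definition ldlq_err rnd W U : 'M[R]_(m, n) :=
  \matrix_(i, j) (rnd i j (ldlq_arg rnd W U i j) - ldlq_arg rnd W U i j).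

Lemma ldlq_errE rnd W U : strict_upper U ->
  (ldlq rnd W U - W) *m (U + 1%:M) = ldlq_err rnd W U.
Proof.
move=> Uup; apply/matrixP => i j.
have sub (A B : 'M[R]_(m, n)) k l : (A - B) k l = A k l - B k l by rewrite !mxE.
rewrite mulmxDr mulmx1 [LHS]mxE [X in X + _]mxE [RHS]mxE sub -ldlq_col ldlq_argE//.
rewrite opprD [LHS]addrC [RHS]addrA; congr (_ + _).
rewrite -sumrN [RHS]big_mkcond /=; apply: eq_bigr => l _.
rewrite sub -ldlq_col.
by case: ltnP => lj; [rewrite -mulNr opprB|rewrite Uup// mulr0].
Qed.

Lemma mxtrace_quad (A : 'M[R]_(m, n)) (H : 'M[R]_n) :
  \tr (A *m H *m A^T) = \sum_i \sum_k \sum_l A i k * H k l * A i l.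
Proof.
apply: eq_bigr => i _; rewrite mxE [RHS]exchange_big /=.
apply: eq_bigr => l _; rewrite !mxE mulr_suml.
by apply: eq_bigr => k _.
Qed.

Lemma qloss_ldlq rnd W U d H : is_LDL H U d ->
  qloss (ldlq rnd W U) W H = \sum_p d 0 p.2 * ldlq_err rnd W U p.1 p.2 ^+ 2.
Proof.
move=> [Uup _ ->]; rewrite /qloss !mulmxA -mulmxA -trmx_mul ldlq_errE//.
rewrite -(pair_bigA _ (fun i j => d 0 j * ldlq_err rnd W U i j ^+ 2)) /=.
rewrite mxtrace_quad; apply: eq_bigr => i _; apply: eq_bigr => k _.
rewrite (bigD1 k)//= big1 => [|l lk].
  by rewrite addr0 [diag_mx _ _ _]mxE eqxx mulr1n; ring.
by rewrite [diag_mx _ _ _]mxE eq_sym (negPf lk) mulr0n mulr0 mul0r.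
Qed.

End LDLQ.

Lemma LDL_trace n (H U : 'M[R]_n) (d : 'rV[R]_n) : is_LDL H U d ->
  \sum_j d 0 j <= \tr H.
Proof.
move=> [Uup d_ge0 ->]; apply: ler_sum => k _.
rewrite mxE (bigD1 k)//= mul_mx_diag !mxE Uup// eqxx add0r mul1r mulr1 lerDl.
apply: sumr_ge0 => l lk; rewrite !mxE eq_sym (negPf lk) addr0 mulrAC -expr2.
by rewrite mulr_ge0 ?sqr_ge0.
Qed.

Lemma LDL_diag n (d' : 'rV[R]_n) (U : 'M[R]_n) (d : 'rV[R]_n) :
  is_LDL (diag_mx d') U d -> d = d' /\ forall l j, U l j * d 0 j = 0.
Proof.
move=> [Uup d_ge0 HE].
have entry k l : diag_mx d' k l = \sum_j (U + 1%:M) k j * d 0 j * (U + 1%:M) l j.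
  rewrite HE mxE; apply: eq_bigr => j _.
  by rewrite mul_mx_diag !mxE.
have Ud l j : U l j * d 0 j = 0.
  (* Columns are treated from right to left. For [l < j] the zero entry at [(l, j)] equals
     [U l j * d 0 j] plus terms of other columns [j'], which vanish by triangularity if [j' < j] and
     by induction if [j' > j]. *)
  have [k] := ubnP (n - j)%N; elim: k l j => // k IH l j jk.
  have [jl|lj] := leqP j l; first by rewrite Uup// mul0r.
  have := entry l j; rewrite mxE -val_eqE /= ltn_eqF// mulr0n (bigD1 j)//=.
  rewrite big1 => [|j' j'j].
    by rewrite addr0 !mxE eqxx -val_eqE /= ltn_eqF// addr0 (Uup j j)// add0r mulr1.
  rewrite [(U + _) j j']mxE [1%:M j j']mxE eq_sym (negPf j'j) addr0.
  have [j'_le|j_lt] := leqP j' j; first by rewrite Uup// mulr0.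
  by rewrite -mulrA [d 0 j' * _]mulrC IH ?mulr0//; have := ltn_ord j'; lia.
split=> //; apply/rowP => k.
have := entry k k; rewrite mxE eqxx mulr1n => ->.
rewrite (bigD1 k)//= big1 => [|j jk].
  by rewrite !mxE eqxx Uup// add0r mul1r mulr1 addr0.
by rewrite !mxE eq_sym (negPf jk) addr0 Ud mul0r.
Qed.

End Algorithm.

(** * Sequential coin flips whose probabilities depend on earlier outcomes *)

Section CoinFlips.
Set Implicit Arguments.
Unset Strict Implicit.
Context {R : realType}.
Variables (P : finType) (rank : P -> nat).
Hypothesis rank_inj : injective rank.
Implicit Types (b : {ffun P -> bool}) (e p q : P).

Definition flip e b : {ffun P -> bool} := [ffun q => (q == e) (+) b q].

Lemma flipK e : involutive (flip e).
Proof. by move=> b; apply/ffunP => q; rewrite !ffunE addbA addbb. Qed.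

Lemma flip_eq e b : flip e b e = ~~ b e.
Proof. by rewrite ffunE eqxx. Qed.

Lemma flip_neq e q b : q != e -> flip e b q = b q.
Proof. by rewrite ffunE => /negPf ->. Qed.

(** Flipping is an involution, so each sum is half the sum of its symmetrization in the coin [e]. *)
Lemma sum_flip e (F G : {ffun P -> bool} -> R) :
  (forall b, F b + F (flip e b) = G b + G (flip e b)) ->
  \sum_b F b = \sum_b G b.
Proof.
have sym (K : {ffun P -> bool} -> R) :
    \sum_b (K b + K (flip e b)) = 2 * \sum_b K b.
  rewrite big_split /= mulr_natl mulr2n; congr (_ + _).
  by rewrite [RHS](reindex_inj (inv_inj (flipK e))).
move=> FG; have /mulfI : (2 : R) != 0 by rewrite pnatr_eq0.
by apply; rewrite -!sym; apply: eq_bigr.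
Qed.

(** [z b p] is the number to be rounded at [p] when the coins fall as [b]: a predictable process for
    the order given by [rank]. *)
Variable z : {ffun P -> bool} -> P -> R.
Hypothesis z_adapted : forall b e q, (rank q <= rank e)%N -> z (flip e b) q = z b q.

(* Coins of rank < r follow the rounding probabilities, the others are fair: on
   functions of the coins of rank < r, all the weights of index at least r have
   the same expectation. *)
Definition weight (r : nat) b : R :=
  \prod_q (if (rank q < r)%N then bit_prob (b q) (z b q) else 2^-1).

Lemma bit_prob_ge0 (c : bool) (y : R) : 0 <= bit_prob c y.
Proof.
rewrite /bit_prob /fracR /floorR; case: c; first by rewrite subr_ge0 ge_floor.
by rewrite opprB addrA subr_ge0 addrC -intrD1 ltW// floorD1_gt.
Qed.

Lemma weight_ge0 r b : 0 <= weight r b.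
Proof. by apply: prodr_ge0 => q _; case: ifP => _; rewrite ?bit_prob_ge0// invr_ge0. Qed.

Lemma weight_full r b : (forall q, (rank q < r)%N) ->
  weight r b = \prod_q bit_prob (b q) (z b q).
Proof. by move=> r_top; apply: eq_bigr => q _; rewrite r_top. Qed.

(* Averages over the coin e, on which the rest of the weight does not depend. *)
Lemma sum_weight_step e (g h : {ffun P -> bool} -> R) :
  (forall b, bit_prob (b e) (z b e) * g b + bit_prob (~~ b e) (z b e) * g (flip e b)
             = 2^-1 * (h b + h (flip e b))) ->
  \sum_b weight (rank e).+1 b * g b = \sum_b weight (rank e) b * h b.
Proof.
move=> gh; apply: (sum_flip (e := e)) => b.
rewrite /weight !(bigD1 e (P := predT))//= !ltnS leqnn ltnn flip_eq z_adapted//.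
pose X b' := \prod_(q | q != e)
  (if (rank q < rank e)%N then bit_prob (b' q) (z b' q) else 2^-1).
have XE b' : \prod_(q | q != e)
    (if (rank q <= rank e)%N then bit_prob (b' q) (z b' q) else 2^-1) = X b'.
  apply: eq_bigr => q qe; rewrite leq_eqVlt; case: eqP => [/rank_inj qe'|//].
  by rewrite qe' eqxx in qe.
have XF : X (flip e b) = X b.
  by apply: eq_bigr => q qe; case: ifP => // qlt; rewrite z_adapted 1?ltnW// flip_neq.
rewrite !XE -!/(X _) XF.
transitivity (X b * (2^-1 * (h b + h (flip e b)))); first by rewrite -gh; ring.
ring.
Qed.

(** Indices are lowered one at a time: a coin that [g] ignores contributes total mass one, whether
    fair or biased. *)
Lemma sum_weight_shift r (g : {ffun P -> bool} -> R) :
  (forall b e, (r <= rank e)%N -> g (flip e b) = g b) ->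
  forall r', (r <= r')%N -> \sum_b weight r' b * g b = \sum_b weight r b * g b.
Proof.
move=> g_inv; elim=> [|r' IH]; first by rewrite leqn0 => /eqP ->.
rewrite leq_eqVlt => /predU1P[->//|]; rewrite ltnS => rr'.
rewrite -(IH rr').
(* [rank] need not be onto; where no coin has rank [r'], the two weights coincide. *)
have [[e er]|noe] := pselect (exists e, rank e = r').
  rewrite -er; apply: sum_weight_step => b; rewrite g_inv ?er//.
  by rewrite /bit_prob; case: (b e) => /=; field.
apply: eq_bigr => b _; congr (_ * _); apply: eq_bigr => q _.
rewrite ltnS leq_eqVlt; case: eqP => // qr'.
by case: noe; exists q.
Qed.

(** A constant ignores all coins, so the index drops to zero, where the weight is uniform. *)
Lemma sum_weight1 r : \sum_b weight r b = 1.
Proof.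
under eq_bigr do rewrite -[weight _ _]mulr1.
rewrite (@sum_weight_shift 0%N (fun=> 1))//.
under eq_bigr do rewrite mulr1 /weight /= prodr_const.
by rewrite sumr_const card_ffun card_bool -[_ *+ (_ ^ _)]mulr_natl natrX -exprMn divff ?expr1n.
Qed.

Let N := (\max_q rank q).+1.

Let rank_ltN q : (rank q < N)%N.
Proof. exact: (leq_bigmax (F := rank)). Qed.

(** Later coins are dropped first; then the coin [p] is averaged with the earlier ones fixed, which
    gives the Bernoulli variance. *)
Lemma expect_sqr_err p :
  \sum_(b : {ffun P -> bool}) (\prod_q bit_prob (b q) (z b q)) *
    ((b p)%:R - fracR (z b p)) ^+ 2 =
  \sum_b weight (rank p) b * (fracR (z b p) * (1 - fracR (z b p))).
Proof.
under eq_bigr do rewrite -(weight_full (r := N))//.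
rewrite [LHS](sum_weight_shift (r := (rank p).+1))//; last first.
  move=> b e pe; rewrite flip_neq ?z_adapted 1?ltnW//.
  by apply/eqP => ep; rewrite ep ltnn in pe.
apply: sum_weight_step => b; rewrite flip_eq z_adapted//.
by rewrite /bit_prob; case: (b p) => /=; rewrite ?mulr1n ?mulr0n; field.
Qed.

(** Once the coins before [q] are fixed, so is the error at [p], and the error at [q] has mean zero
    because the rounding is unbiased. *)
Lemma expect_cross_err p q : (rank p < rank q)%N ->
  \sum_(b : {ffun P -> bool}) (\prod_q bit_prob (b q) (z b q)) *
    (((b p)%:R - fracR (z b p)) * ((b q)%:R - fracR (z b q))) = 0.
Proof.
move=> pq; under eq_bigr do rewrite -(weight_full (r := N))//.
rewrite [LHS](sum_weight_shift (r := (rank q).+1))//; last first.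
  move=> b e qe; have pe := ltn_trans pq qe.
  rewrite !flip_neq ?z_adapted 1?ltnW//; apply/eqP => E; first by rewrite E ltnn in qe.
  by rewrite E ltnn in pe.
rewrite (sum_weight_step (h := fun=> 0)) => [|b]; first by apply: big1 => b _; rewrite mulr0.
rewrite (z_adapted _ (ltnW pq)) (z_adapted _ (leqnn _)) flip_eq flip_neq; last first.
  by apply/eqP => E; rewrite E ltnn in pq.
by rewrite /bit_prob; case: (b q) => /=; rewrite ?mulr1n ?mulr0n; ring.
Qed.

End CoinFlips.

(** * Loss of LDLQ with stochastic and with nearest rounding *)

Section LDLQStoch.
Set Implicit Arguments.
Unset Strict Implicit.
Context {R : realType}.
Local Notation mu := (@lebesgue_measure R).
Context {m n : nat}.
Implicit Types (W : 'M[R]_(m, n)) (U H : 'M[R]_n) (d : 'rV[R]_n).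
Implicit Types (p q e : 'I_m * 'I_n) (b : {ffun 'I_m * 'I_n -> bool}).

Lemma fracR_var_le (y : R) : fracR y * (1 - fracR y) <= 4^-1.
Proof. by have := sqr_ge0 (fracR y - 2^-1); set t := fracR y; rewrite expr2; lra. Qed.

Lemma bit_round_err b i k (y : R) : bit_round b i k y - y = (b (i, k))%:R - fracR y.
Proof. by rewrite /bit_round /fracR; ring. Qed.

Lemma sum_columns (c : 'I_n -> R) : \sum_(p : 'I_m * 'I_n) c p.2 = m%:R * \sum_k c k.
Proof.
rewrite -(pair_bigA _ (fun _ k => c k)) /= sumr_const card_ord.
by rewrite mulr_natl.
Qed.

Lemma ldlq_arg_set_later rnd W U p e x : strict_upper U -> (rank p < rank e)%N ->
  ldlq_arg rnd (set_entry W e x) U p.1 p.2 = ldlq_arg rnd W U p.1 p.2.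
Proof.
case: p => i j /= Uup pe; apply: ldlq_arg_ext => //= l lj.
apply: (@set_entry_neq _ _ _ W (i, l) e x); apply: contraTneq pe => <-.
by rewrite rank_lt -leqNgt.
Qed.

Definition stoch_arg U W b p : R := ldlq_arg (bit_round b) W U p.1 p.2.

Lemma stoch_arg_adapted U W b e q : strict_upper U -> (rank q <= rank e)%N ->
  stoch_arg U W (flip e b) q = stoch_arg U W b q.
Proof.
case: q => i j Uup qe; apply: ldlq_arg_ext => //= l lj y.
rewrite /bit_round flip_neq//; apply: contraTneq qe => <-.
by rewrite -ltnNge rank_lt.
Qed.

(** Contribution of [p] to the expected loss, with the coin [p] and all later ones averaged out. In
    this form it involves only entries of [W] of rank at most [rank p], and the entry [p] only
    through its own rounding argument, as the iterated averaging demands. *)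
Definition stoch_term U d p W : R := d 0 p.2 *
  \sum_b weight rank (stoch_arg U W) (rank p) b *
    (fracR (stoch_arg U W b p) * (1 - fracR (stoch_arg U W b p))).

Lemma E_ldlq_stochE U W d H : is_LDL H U d ->
  E_ldlq_stoch U W H = \sum_p stoch_term U d p W.
Proof.
move=> HUd; have [Uup _ _] := HUd; rewrite /E_ldlq_stoch.
under eq_bigr do rewrite (qloss_ldlq _ _ HUd) mulr_sumr.
rewrite exchange_big /=; apply: eq_bigr => p _; rewrite /stoch_term.
rewrite -expect_sqr_err; last 2 first.
- exact: rank_inj.
- by move=> b e q; exact: stoch_arg_adapted.
rewrite mulr_sumr; apply: eq_bigr => b _.
by rewrite mulrCA mxE bit_round_err -surjective_pairing.
Qed.

Lemma E_ldlq_stoch_le U W d H : is_LDL H U d ->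
  E_ldlq_stoch U W H <= m%:R / 4 * \sum_k d 0 k.
Proof.
move=> HUd; have [Uup d_ge0 _] := HUd; rewrite (E_ldlq_stochE W HUd).
rewrite -mulrA mulr_sumr -(sum_columns (fun k => 4^-1 * d 0 k)).
apply: ler_sum => p _; rewrite /stoch_term [X in _ <= X]mulrC ler_wpM2l//.
(* The weights sum to one, so the bound is itself an average and the comparison goes pattern by
   pattern. *)
have -> : 4^-1 = \sum_b weight rank (stoch_arg U W) (rank p) b * 4^-1.
  rewrite -mulr_suml sum_weight1 ?mul1r//; first exact: rank_inj.
  by move=> b e q; exact: stoch_arg_adapted.
by apply: ler_sum => b _; rewrite ler_wpM2l ?weight_ge0// fracR_var_le.
Qed.

Lemma L_avg_ldlq_stoch U d H : is_LDL H U d ->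
  L_avg (fun W => E_ldlq_stoch U W H) = m%:R / 6 * \sum_k d 0 k.
Proof.
move=> HUd; have [Uup _ _] := HUd.
under [X in L_avg X]funext do rewrite (E_ldlq_stochE _ HUd).
rewrite -mulrA mulr_sumr -(sum_columns (fun k => 6^-1 * d 0 k)).
have argE p W x e b : (rank p < rank e)%N ->
    stoch_arg U (set_entry W e x) b p = stoch_arg U W b p.
  exact: ldlq_arg_set_later.
have weightE p W x e b : (rank p <= rank e)%N ->
    weight rank (stoch_arg U (set_entry W e x)) (rank p) b =
    weight rank (stoch_arg U W) (rank p) b.
  move=> pe; apply: eq_bigr => q _; case: ifP => // qp.
  by rewrite argE// (leq_trans qp).
apply: L_avg_sum => [p e W x pe|p W C].
  by congr (_ * _); apply: eq_bigr => b _; rewrite weightE 1?ltnW// argE.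
pose w b := weight rank (stoch_arg U W) (rank p) b.
(* With [u] the fractional part at [p], the summand is [d * w b * (u - u ^+ 2)], and
   [1 / 2 - 1 / 3 = 1 / 6]. The weights [w b] do not see the entry [p]. *)
have := Rintegral_sum_fracR (fun=> 0) (fun b => d 0 p.2 * w b)
  (fun b => - (d 0 p.2 * w b)) (fun b => stoch_arg U W b p - W p.1 p.2) C.
have -> : \sum_b (0 + d 0 p.2 * w b / 2 + - (d 0 p.2 * w b) / 3) = 6^-1 * d 0 p.2.
  transitivity (\sum_b (6^-1 * d 0 p.2) * w b); first by apply: eq_bigr => b _; field.
  rewrite -mulr_sumr sum_weight1 ?mulr1//; first exact: rank_inj.
  by move=> b e q; exact: stoch_arg_adapted.
move=> <-; apply: eq_Rintegral => x _; congr (_ + _).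
rewrite /stoch_term mulr_sumr; apply: eq_bigr => b _; rewrite weightE//.
have -> : stoch_arg U (set_entry W p x) b p = x + (stoch_arg U W b p - W p.1 p.2).
  by rewrite /stoch_arg; case: (p) => i j; exact: ldlq_arg_set_entry.
rewrite -/(w b); ring.
Qed.

Definition near_term U d p W : R := d 0 p.2 *
  (2^-1 - fracR (ldlq_arg (fun _ _ => @near_round R) W U p.1 p.2 + 2^-1)) ^+ 2.

Lemma E_ldlq_nearE U W d H : is_LDL H U d ->
  E_ldlq_near U W H = \sum_p near_term U d p W.
Proof.
move=> HUd; rewrite /E_ldlq_near (qloss_ldlq _ _ HUd).
by apply: eq_bigr => p _; rewrite mxE near_roundE.
Qed.

Lemma E_ldlq_near_le U W d H : is_LDL H U d ->
  E_ldlq_near U W H <= m%:R / 4 * \sum_k d 0 k.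
Proof.
move=> HUd; have [Uup d_ge0 _] := HUd; rewrite (E_ldlq_nearE W HUd).
rewrite -mulrA mulr_sumr -(sum_columns (fun k => 4^-1 * d 0 k)).
apply: ler_sum => p _; rewrite /near_term [X in _ <= X]mulrC ler_wpM2l//.
set y := (X in fracR X); have := fracR_ge0 y; have := fracR_lt1 y; set t := fracR y.
by rewrite expr2; nra.
Qed.

Lemma L_avg_ldlq_near U d H : is_LDL H U d ->
  L_avg (fun W => E_ldlq_near U W H) = m%:R / 12 * \sum_k d 0 k.
Proof.
move=> HUd; have [Uup _ _] := HUd.
under [X in L_avg X]funext do rewrite (E_ldlq_nearE _ HUd).
rewrite -mulrA mulr_sumr -(sum_columns (fun k => 12^-1 * d 0 k)).
apply: L_avg_sum => [p e W x pe|p W C].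
  by rewrite /near_term ldlq_arg_set_later.
pose a := ldlq_arg (fun _ _ => @near_round R) W U p.1 p.2 - W p.1 p.2 + 2^-1.
(* Expansion of [d * (1 / 2 - u) ^+ 2] in the fractional part [u]; its average is
   [1 / 4 - 1 / 2 + 1 / 3 = 1 / 12] times [d]. *)
have := Rintegral_sum_fracR (fun _ : 'I_1 => d 0 p.2 / 4) (fun=> - d 0 p.2)
  (fun=> d 0 p.2) (fun=> a) C.
rewrite big_ord1 => E; transitivity (C + (d 0 p.2 / 4 + - d 0 p.2 / 2 + d 0 p.2 / 3)).
  rewrite -{}E; apply: eq_Rintegral => x _; rewrite big_ord1; congr (_ + _).
  rewrite /near_term; case: p @a => i j a; rewrite ldlq_arg_set_entry//= -addrA -/a.
  by field.
by field.
Qed.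

(** A column receives no feedback unless its weight [d] vanishes. The factor [d] stays on both sides
    because columns of [U] with zero weight are unconstrained above the diagonal. *)
Lemma LDL_diag_arg (d' : 'rV[R]_n) U d rnd W p (F : R -> R) : is_LDL (diag_mx d') U d ->
  d 0 p.2 * F (ldlq_arg rnd W U p.1 p.2) = d 0 p.2 * F (W p.1 p.2).
Proof.
move=> HUd; have [Uup _ _] := HUd; have [_ Ud] := LDL_diag HUd.
have [->|dp] := eqVneq (d 0 p.2) 0; first by rewrite !mul0r.
rewrite ldlq_argE// big1 ?addr0// => l _.
by move/eqP: (Ud l p.2); rewrite mulf_eq0 (negPf dp) orbF => /eqP ->; rewrite mulr0.
Qed.

Lemma fracR_half : fracR (2^-1 : R) = 2^-1.
Proof. by rewrite (@fracR_eq _ _ 0) ?subr0//; lra. Qed.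

Lemma fracR1 : fracR (2^-1 + 2^-1 : R) = 0.
Proof. by rewrite (@fracR_eq _ _ 1); lra. Qed.

(** Entries [1 / 2] are ties, at the largest possible distance from the integers. *)
Lemma E_ldlq_near_diag (d' : 'rV[R]_n) U d : is_LDL (diag_mx d') U d ->
  E_ldlq_near U (const_mx 2^-1 : 'M[R]_(m, n)) (diag_mx d') = m%:R / 4 * \sum_k d 0 k.
Proof.
move=> HUd; rewrite (E_ldlq_nearE _ HUd).
rewrite -mulrA mulr_sumr -(sum_columns (fun k => 4^-1 * d 0 k)).
apply: eq_bigr => p _.
rewrite /near_term (LDL_diag_arg _ _ _ (fun y => (2^-1 - fracR (y + 2^-1)) ^+ 2) HUd).
by rewrite mxE fracR1; field.
Qed.

(** At [1 / 2] the Bernoulli variance reaches its maximum [1 / 4]. *)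
Lemma E_ldlq_stoch_diag (d' : 'rV[R]_n) U d : is_LDL (diag_mx d') U d ->
  E_ldlq_stoch U (const_mx 2^-1 : 'M[R]_(m, n)) (diag_mx d') = m%:R / 4 * \sum_k d 0 k.
Proof.
move=> HUd; have [Uup _ _] := HUd; rewrite (E_ldlq_stochE _ HUd).
rewrite -mulrA mulr_sumr -(sum_columns (fun k => 4^-1 * d 0 k)).
apply: eq_bigr => p _; rewrite /stoch_term mulr_sumr.
under eq_bigr => b _.
  rewrite mulrCA /stoch_arg (LDL_diag_arg _ _ _ (fun y => fracR y * (1 - fracR y)) HUd).
  rewrite mxE fracR_half.
  over.
rewrite -mulr_suml sum_weight1 ?mul1r//; first by field.
- exact: rank_inj.
- by move=> b e q; exact: stoch_arg_adapted.
Qed.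

End LDLQStoch.

(** * Entrywise rounding, and suprema that are attained *)

Section Entrywise.
Set Implicit Arguments.
Unset Strict Implicit.
Context {R : realType}.
Local Notation mu := (@lebesgue_measure R).
Context {m n : nat}.
Implicit Types (W : 'M[R]_(m, n)) (H : 'M[R]_n) (p q e : 'I_m * 'I_n).

(** The triangle [k < l] is folded onto [l < k], so that each cross term can be charged to the later
    of its two columns. *)
Lemma sum_symmetric (s : 'I_n -> 'I_n -> R) : (forall k l, s k l = s l k) ->
  \sum_k \sum_l s k l = \sum_(k < n) (s k k + 2 * \sum_(l < n | (l < k)%N) s k l).
Proof.
move=> sC.
have -> : \sum_k \sum_l s k l = \sum_k s k k +
    (\sum_(k < n) \sum_(l < n | (l < k)%N) s k l +
     \sum_(k < n) \sum_(l < n | (k < l)%N) s k l).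
  rewrite -!big_split /=; apply: eq_bigr => k _; rewrite (bigD1 k)//=; congr (_ + _).
  rewrite (bigID (fun l : 'I_n => (l < k)%N)) /=; congr (_ + _); apply: eq_bigl => l.
    by rewrite -val_eqE /=; case: ltngtP.
  by rewrite -val_eqE /=; case: ltngtP.
rewrite [X in _ + (_ + X)](exchange_big_dep predT)//=.
rewrite [X in _ + (_ + X)](_ : _ = \sum_(k < n) \sum_(l < n | (l < k)%N) s k l); last first.
  by apply: eq_bigr => k _; apply: eq_bigr => l _.
rewrite big_split /= -mulr_sumr; ring.
Qed.

Definition near_err W i k : R := 2^-1 - fracR (W i k + 2^-1).

(** Cross terms are charged to their entry of higher rank, so this depends only on entries of rank
    at most [rank p]; averaging over the entry [p] kills them, as its error has mean zero. *)
Definition near_quad_term H p W : R := H p.2 p.2 * near_err W p.1 p.2 ^+ 2 +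
  2 * \sum_(l < n | (l < p.2)%N) near_err W p.1 p.2 * H p.2 l * near_err W p.1 l.

Lemma E_nearE W H : H^T = H -> E_near W H = \sum_p near_quad_term H p W.
Proof.
move=> symH; rewrite /E_near /qloss mxtrace_quad.
have errE i k : (map_mx (@near_round R) W - W) i k = near_err W i k.
  by rewrite !mxE near_roundE.
rewrite -(pair_bigA _ (fun i k => near_quad_term H (i, k) W)) /=.
apply: eq_bigr => i _; rewrite sum_symmetric => [|k l].
  apply: eq_bigr => k _; rewrite !errE /near_quad_term /=; congr (_ + _ * _); first by ring.
  by apply: eq_bigr => l _; rewrite !errE.
by rewrite !errE -[in RHS]symH [H^T _ _]mxE; ring.
Qed.

Lemma L_avg_near H : H^T = H ->
  L_avg (fun W : 'M[R]_(m, n) => E_near W H) = m%:R / 12 * \tr H.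
Proof.
move=> symH; under [X in L_avg X]funext do rewrite (E_nearE _ symH).
rewrite -mulrA mulr_sumr -(sum_columns (fun k => 12^-1 * H k k)).
have err_neq W e x i l : (i, l) != e -> near_err (set_entry W e x) i l = near_err W i l.
  by move=> ne; rewrite /near_err (@set_entry_neq _ _ _ W (i, l)).
apply: L_avg_sum => [p e W x pe|[i k] W C].
  have p_e (l : 'I_n) : (l <= p.2)%N -> (p.1, l) != e.
    move=> lp; apply: contraTneq pe => <-; case: p lp => i k /= lk.
    by rewrite -leqNgt rank_le.
  rewrite /near_quad_term !err_neq ?p_e//; congr (_ + _ * _).
  by apply: eq_bigr => l lp; rewrite !err_neq ?p_e// ltnW.
(* With [u] the fractional part at [(i, k)], the term is [H k k * (1 / 2 - u) ^+ 2 + 2 * S * (1 / 2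
   - u)]; [S] cancels in the average. *)
pose S := \sum_(l < n | (l < k)%N) H k l * near_err W i l.
have := Rintegral_sum_fracR (fun _ : 'I_1 => H k k / 4 + S)
  (fun=> - H k k - 2 * S) (fun=> H k k) (fun=> 2^-1) C.
rewrite big_ord1 => E.
transitivity (C + (H k k / 4 + S + (- H k k - 2 * S) / 2 + H k k / 3)); last by field.
rewrite -{}E; apply: eq_Rintegral => x _; rewrite big_ord1; congr (_ + _).
rewrite /near_quad_term /=.
have -> : near_err (set_entry W (i, k) x) i k = 2^-1 - fracR (x + 2^-1).
  by rewrite /near_err (@set_entry_eq _ _ _ W (i, k)).
rewrite (eq_bigr (fun l => (2^-1 - fracR (x + 2^-1)) * (H k l * near_err W i l))).
  by rewrite -mulr_sumr -/S; field.
move=> l lk; rewrite err_neq ?mulrA//.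
by rewrite xpair_eqE eqxx -val_eqE /= ltn_eqF.
Qed.

Lemma E_stochE W H :
  E_stoch W H = \sum_p H p.2 p.2 * (fracR (W p.1 p.2) * (1 - fracR (W p.1 p.2))).
Proof.
(* The rounded numbers are constant in the coins, a special case of the sequential setting. *)
pose z (b : {ffun 'I_m * 'I_n -> bool}) (p : 'I_m * 'I_n) := W p.1 p.2.
have zA b e q : (rank q <= rank e)%N -> z (flip e b) q = z b q by [].
pose w (b : {ffun 'I_m * 'I_n -> bool}) := \prod_p bit_prob (b p) (z b p).
pose err (b : {ffun 'I_m * 'I_n -> bool}) p := (b p)%:R - fracR (z b p).
have cross p q : p != q -> \sum_b w b * (err b p * err b q) = 0.
  move=> pq; have [lt_pq|lt_qp|/rank_inj E] := ltngtP (rank p) (rank q).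
  - exact: (expect_cross_err (rank_inj (n := n)) zA lt_pq).
  - under eq_bigr do rewrite [err _ p * _]mulrC.
    exact: (expect_cross_err (rank_inj (n := n)) zA lt_qp).
  - by rewrite E eqxx in pq.
have diag p : \sum_b w b * err b p ^+ 2 = fracR (W p.1 p.2) * (1 - fracR (W p.1 p.2)).
  rewrite (expect_sqr_err (rank_inj (n := n)) zA p).
  rewrite -[LHS]/(\sum_b weight rank z (rank p) b *
    (fracR (W p.1 p.2) * (1 - fracR (W p.1 p.2)))).
  rewrite -mulr_suml sum_weight1 ?mul1r//.
  exact: rank_inj.
transitivity (\sum_b \sum_i \sum_k \sum_l H k l * (w b * (err b (i, k) * err b (i, l)))).
  apply: eq_bigr => b _; rewrite /qloss mxtrace_quad mulr_sumr; apply: eq_bigr => i _.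
  rewrite mulr_sumr; apply: eq_bigr => k _; rewrite mulr_sumr; apply: eq_bigr => l _.
  have errE j : ((\matrix_(i, j) (floorR (W i j) + (b (i, j))%:R)) - W) i j = err b (i, j).
    by rewrite !mxE /err /z /fracR /=; ring.
  by rewrite !errE -/(w b); ring.
rewrite exchange_big.
rewrite -(pair_bigA _ (fun i k => H k k * (fracR (W i k) * (1 - fracR (W i k))))) /=.
apply: eq_bigr => i _; rewrite exchange_big; apply: eq_bigr => k _.
rewrite exchange_big (bigD1 k)//= [X in _ + X]big1 => [|l lk].
  by rewrite addr0 -mulr_sumr; congr (_ * _); rewrite -(diag (i, k)); apply: eq_bigr.
rewrite -mulr_sumr cross ?mulr0//.
by rewrite xpair_eqE eqxx eq_sym.
Qed.

Lemma L_avg_stoch H : L_avg (fun W : 'M[R]_(m, n) => E_stoch W H) = m%:R / 6 * \tr H.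
Proof.
under [X in L_avg X]funext do rewrite E_stochE.
rewrite -mulrA mulr_sumr -(sum_columns (fun k => 6^-1 * H k k)).
apply: (L_avg_sum (T := fun p W => H p.2 p.2 * (fracR (W p.1 p.2) * (1 - fracR (W p.1 p.2)))))
  => [p e W x pe|p W C].
  by rewrite set_entry_neq//; apply: contraTneq pe => ->; rewrite ltnn.
have := Rintegral_sum_fracR (fun _ : 'I_1 => 0) (fun=> H p.2 p.2)
  (fun=> - H p.2 p.2) (fun=> 0) C.
rewrite big_ord1 => E; transitivity (C + (0 + H p.2 p.2 / 2 + - H p.2 p.2 / 3)).
  rewrite -{}E; apply: eq_Rintegral => x _; rewrite big_ord1; congr (_ + _).
  by rewrite set_entry_eq addr0; ring.
by field.
Qed.

Lemma E_stoch_le W H : psd H -> E_stoch W H <= m%:R / 4 * \tr H.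
Proof.
move=> psdH; rewrite E_stochE -mulrA mulr_sumr -(sum_columns (fun k => 4^-1 * H k k)).
apply: ler_sum => p _; rewrite [X in _ <= X]mulrC.
by rewrite ler_wpM2l ?fracR_var_le// psd_diag.
Qed.

Lemma E_stoch_half H : E_stoch (const_mx 2^-1 : 'M[R]_(m, n)) H = m%:R / 4 * \tr H.
Proof.
rewrite E_stochE -mulrA mulr_sumr -(sum_columns (fun k => 4^-1 * H k k)).
by apply: eq_bigr => p _; rewrite mxE fracR_half; field.
Qed.

Lemma ereal_sup_max (S : set \bar R) (c : \bar R) :
  (forall x, S x -> (x <= c)%E) -> S c -> ereal_sup S = c.
Proof.
move=> ub Sc; apply/eqP; rewrite eq_le; apply/andP; split; first exact: ge_ereal_sup.
exact: ereal_sup_ubound.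
Qed.

Lemma L_worst_le (E : 'M[R]_(m, n) -> R) c :
  (forall W, E W <= c) -> (L_worst E <= c%:E)%E.
Proof. by move=> Ec; apply: ge_ereal_sup => _ [W _ <-]; rewrite lee_fin. Qed.

Lemma L_worst_max (E : 'M[R]_(m, n) -> R) c W : (forall W, E W <= c) -> E W = c ->
  L_worst E = c%:E.
Proof.
move=> Ec EW; apply: ereal_sup_max; last by exists W; rewrite ?EW.
by move=> _ [W' _ <-]; rewrite lee_fin.
Qed.

End Entrywise.

(** * Evaluation of the suprema over the matrices with the spectrum of [H] *)

Theorem theorem4 (R : realType) (m n : nat) (H : 'M[R]_n)
  (ldlU : 'M[R]_n -> 'M[R]_n) (ldlD : 'M[R]_n -> 'rV[R]_n) :
  psd H ->
  (forall Ht, same_spectrum_set H Ht -> is_LDL Ht (ldlU Ht) (ldlD Ht)) ->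
  [/\ ereal_sup [set L_worst (fun W : 'M[R]_(m, n) => E_ldlq_near (ldlU Ht) W Ht)
                 | Ht in same_spectrum_set H]
        = L_worst (fun W : 'M[R]_(m, n) => E_stoch W H),
      ereal_sup [set L_worst (fun W : 'M[R]_(m, n) => E_ldlq_stoch (ldlU Ht) W Ht)
                 | Ht in same_spectrum_set H]
        = L_worst (fun W : 'M[R]_(m, n) => E_stoch W H),
      L_worst (fun W : 'M[R]_(m, n) => E_stoch W H) = (m%:R / 4 * \tr H)%:E,
      ereal_sup [set (L_avg (fun W : 'M[R]_(m, n) => E_ldlq_near (ldlU Ht) W Ht))%:E
                 | Ht in same_spectrum_set H]
        = (L_avg (fun W : 'M[R]_(m, n) => E_near W H))%:E
        /\ L_avg (fun W : 'M[R]_(m, n) => E_near W H) = m%:R / 12 * \tr H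
    & ereal_sup [set (L_avg (fun W : 'M[R]_(m, n) => E_ldlq_stoch (ldlU Ht) W Ht))%:E
                 | Ht in same_spectrum_set H]
        = (L_avg (fun W : 'M[R]_(m, n) => E_stoch W H))%:E
        /\ L_avg (fun W : 'M[R]_(m, n) => E_stoch W H) = m%:R / 6 * \tr H].
Proof.
move=> psdH LDL; have [lam lamH] := psd_diag_same_spectrum psdH.
have tr_le Ht c : same_spectrum_set H Ht -> 0 <= c ->
    c * \sum_k ldlD Ht 0 k <= c * \tr H.
  move=> HtH c_ge0; rewrite ler_wpM2l// -(same_spectrum_trace (proj2 HtH)).
  exact: LDL_trace (LDL _ HtH).
(* The trace bound is sharp at [diag_mx lam], whose factor [D] is the matrix itself. *)
have tr_lam : \sum_k ldlD (diag_mx lam) 0 k = \tr H.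
  by rewrite -(same_spectrum_trace (proj2 lamH)) mxtrace_diag (proj1 (LDL_diag (LDL _ lamH))).
have worstE : L_worst (fun W : 'M[R]_(m, n) => E_stoch W H) = (m%:R / 4 * \tr H)%:E.
  by apply: (L_worst_max (W := const_mx 2^-1)) => [W|]; [exact: E_stoch_le|exact: E_stoch_half].
have c_ge0 k : 0 <= m%:R / k%:R :> R by rewrite divr_ge0.
split=> //.
- rewrite worstE; apply: ereal_sup_max => [_ [Ht HtH <-]|].
    apply: L_worst_le => W; apply: le_trans (E_ldlq_near_le W (LDL _ HtH)) _.
    exact: tr_le.
  exists (diag_mx lam) => //; rewrite -tr_lam.
  apply: (L_worst_max (W := const_mx 2^-1)) => [W|].
    exact: E_ldlq_near_le (LDL _ lamH).
  exact: E_ldlq_near_diag (LDL _ lamH).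
- rewrite worstE; apply: ereal_sup_max => [_ [Ht HtH <-]|].
    apply: L_worst_le => W; apply: le_trans (E_ldlq_stoch_le W (LDL _ HtH)) _.
    exact: tr_le.
  exists (diag_mx lam) => //; rewrite -tr_lam.
  apply: (L_worst_max (W := const_mx 2^-1)) => [W|].
    exact: E_ldlq_stoch_le (LDL _ lamH).
  exact: E_ldlq_stoch_diag (LDL _ lamH).
- split; last exact: L_avg_near (proj1 psdH).
  (* The averaged loss is exactly [m / 12] times the sum of [ldlD Ht], so only that sum has to be
     maximized. *)
  rewrite (L_avg_near (proj1 psdH)); apply: ereal_sup_max => [_ [Ht HtH <-]|].
    by rewrite lee_fin (L_avg_ldlq_near (LDL _ HtH)) tr_le.
  by exists (diag_mx lam); rewrite // (L_avg_ldlq_near (LDL _ lamH)) tr_lam.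
- split; last exact: L_avg_stoch.
  rewrite L_avg_stoch; apply: ereal_sup_max => [_ [Ht HtH <-]|].
    by rewrite lee_fin (L_avg_ldlq_stoch (LDL _ HtH)) tr_le.
  by exists (diag_mx lam); rewrite // (L_avg_ldlq_stoch (LDL _ lamH)) tr_lam.
Qed.
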